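(* Let $V$ be a finite vocabulary, $\mathcal{P}$ the set of probability distributions on $V$, $(\mathcal{K}, P_{\mathcal{K}})$ a key space with a key distribution, and $F:\mathcal{P}\times\mathcal{K}\to\mathcal{P}$ a distortion-free watermarking function. Then for every next-token distribution $P\in\mathcal{P}$, $$\mathbb{E}_{k\sim P_{\mathcal{K}}}\big[H(F(P,k))\big]\le H(P),$$ where $H$ denotes Shannon entropy.
   Context: $V$ is a finite nonempty set (the vocabulary), and $\mathcal{P}$ is the space of probability distributions over $V$. A language model's next-token distribution given a prefix, $P_M(\cdot\mid x_{1:t})$, is an element $P$ of $\mathcal{P}$. $\mathcal{K}$ is a key space equipped with a probability distribution $P_{\mathcal{K}}$. A watermarking function is a map $F:\mathcal{P}\times\mathcal{K}\to\mathcal{P}$; write $F(P,k)(x)$ for the probability that $F(P,k)$ assigns to $x\in V$. For each $P$ the map $k\mapsto F(P,k)$ is measurable. $F$ is distortion-free if for every $P\in\mathcal{P}$ and every $x\in V$, $\mathbb{E}_{k\sim P_{\mathcal{K}}}[F(P,k)(x)]=P(x)$. Shannon entropy is $H(P)=-\sum_{x\in V}P(x)\log P(x)$ (natural logarithm, $0\log 0=0$). *)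

(* Defs.v *)
From mathcomp Require Import all_boot all_order all_algebra.
From mathcomp Require Import all_classical all_reals all_analysis.

Set Implicit Arguments.
Unset Strict Implicit.
Unset Printing Implicit Defensive.

Import Order.TTheory GRing.Theory Num.Theory.

Local Open Scope classical_set_scope.
Local Open Scope ring_scope.

Record dist (R : realType) (V : finType) := Dist {
  prob :> V -> R;
  prob_ge0 : forall x, 0 <= prob x;
  prob_sum1 : \sum_(x : V) prob x = 1 }.

(* The Borel sigma-algebra of the simplex, i.e. the trace of the product
   sigma-algebra of R^V: it is generated by the evaluation maps P |-> P x.
   [dist R V] is not declared a [measurableType], since that structure requires
   a point and [dist R V] is empty when V is. *)
Definition dist_measurable_sets (R : realType) (V : finType) :
    set (set (dist R V)) :=
  <<s [set A | exists (x : V) (B : set R),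
                 measurable B /\ A = [set P : dist R V | B (P x)]] >>.

Definition measurable_dist_fun (R : realType) (V : finType)
    (d : measure_display) (K : measurableType d) (f : K -> dist R V) : Prop :=
  forall A : set (dist R V), dist_measurable_sets A -> measurable (f @^-1` A).

Definition distortion_free (R : realType) (V : finType)
    (d : measure_display) (K : measurableType d) (PK : probability K R)
    (F : dist R V -> K -> dist R V) : Prop :=
  forall (P : dist R V) (x : V), ('E_PK[fun k => F P k x] = (P x)%:E)%E.

(* [ln 0 = 0] in the library, so the convention 0 log 0 = 0 holds. *)
Definition entropy (R : realType) (V : finType) (P : dist R V) : R :=
  - \sum_(x : V) P x * ln (P x).

(* Main.v *)
Require Import Defs.
From mathcomp Require Import all_boot all_order all_algebra.
From mathcomp Require Import all_classical all_reals all_analysis.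
From mathcomp Require Import measurable_realfun ring lra.

(** The entropy is a sum over [x] of [- t ln t] at [t = P x], and [- t ln t] lies
    below its tangent line at every [c > 0]:
      [- t ln t <= c - t (ln c + 1)].
    Taking expectations of this affine bound at [t = F P k x], whose mean is
    [p = P x], gives [E[- t ln t] <= c - p (ln c + 1)].  For [p > 0] the choice
    [c = p] yields [- p ln p]; for [p = 0], let [c] tend to [0]. *)

Import Order.TTheory GRing.Theory Num.Theory.

Local Open Scope classical_set_scope.
Local Open Scope ring_scope.

(** For [t > 0] this is [ln u <= u - 1] at [u = c / t], multiplied by [t]. At [t = 0] the left side
    vanishes and the right side is [c]. *)
Lemma xlnx_tangent (R : realType) (c t : R) :
  0 < c -> 0 <= t -> - (t * ln t) <= c - t * (ln c + 1).
Proof.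
move=> c0; rewrite le_eqVlt => /predU1P[<-|t0].
  by rewrite !mul0r oppr0 addr0 ltW.
have ct0 : 0 < c / t by rewrite divr_gt0.
have : ln (1 + (c / t - 1)) <= c / t - 1 by apply: le_ln1Dx; lra.
rewrite addrC subrK ln_div ?posrE// -(ler_pM2l t0).
have -> : t * (c / t - 1) = c - t by field; rewrite gt_eqF.
by lra.
Qed.

(** Makes the entropy integrands nonnegative, so that their integrals can be compared and summed
    from measurability alone. *)
Lemma xlnx_le0 (R : realType) (t : R) : 0 <= t <= 1 -> t * ln t <= 0.
Proof. by case/andP=> t0 t1; rewrite mulr_ge0_le0// ln_le0. Qed.

Section unit_interval_valued.
Context (R : realType) (d : measure_display) (K : measurableType d).
Context (PK : probability K R) (f : K -> R).
Hypothesis mf : measurable_fun setT f.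
Hypothesis f01 : forall k, 0 <= f k <= 1.

Lemma integrable_unit_interval : PK.-integrable setT (EFin \o f).
Proof.
apply: (@le_integrable _ _ _ PK _ _ _ (EFin \o cst 1)) => //.
- exact/measurable_EFinP.
- by move=> k _ /=; rewrite lee_fin normr1; have /andP[? ?] := f01 k;
    rewrite ger0_norm.
- exact: finite_measure_integrable_cst.
Qed.

Lemma measurable_xlnx : measurable_fun setT (fun k => - (f k * ln (f k))).
Proof.
apply: measurableT_comp => //; apply: measurable_funM => //.
exact: measurableT_comp.
Qed.

Lemma integral_xlnx_tangent (p c : R) : 0 < c ->
  (\int[PK]_k (f k)%:E = p%:E ->
   \int[PK]_k (- (f k * ln (f k)))%:E <= (c - p * (ln c + 1))%:E)%E.
Proof.
(* [a] is the slope of the tangent line at [c], and [c] is its intercept. *)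
move=> c0 Ep; set a := - (ln c + 1).
have affE : (\int[PK]_k (c%:E + a%:E * (f k)%:E) = (c - p * (ln c + 1))%:E)%E.
  rewrite integralD//.
  (* [PK] has total mass 1, so the constant [c] integrates to itself. *)
  - have := expectation_cst PK c; rewrite unlock => ->.
    rewrite integralZl//; last exact: integrable_unit_interval.
    by rewrite Ep -EFinM -EFinD /a mulNr mulrC.
  - exact: finite_measure_integrable_cst.
  - by apply: integrableZl => //; exact: integrable_unit_interval.
rewrite -affE; apply: ge0_le_integral => //.
- by move=> k _; rewrite lee_fin oppr_ge0 xlnx_le0.
- exact/measurable_EFinP/measurable_xlnx.
- apply/measurable_EFinP; apply: measurable_funD => //.
  exact: measurable_funM.
- move=> k _; rewrite -EFinM -EFinD lee_fin /a mulNr [X in c - X]mulrC.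
  by apply: xlnx_tangent => //; case/andP: (f01 k).
Qed.

Lemma integral_xlnx_le (p : R) : 0 <= p -> (\int[PK]_k (f k)%:E = p%:E)%E ->
  (\int[PK]_k (- (f k * ln (f k)))%:E <= (- (p * ln p))%:E)%E.
Proof.
rewrite le_eqVlt => /predU1P[<- Ep|p0 Ep]; last first.
  apply: le_trans (integral_xlnx_tangent _ _ p0 Ep) _.
  by rewrite lee_fin; lra.
rewrite mul0r oppr0; apply/lee_addgt0Pr => e e0.
by have := integral_xlnx_tangent _ _ e0 Ep; rewrite mul0r subr0 add0e.
Qed.

End unit_interval_valued.

Lemma dist_le1 (R : realType) (V : finType) (P : dist R V) (x : V) : P x <= 1.
Proof.
rewrite -(prob_sum1 P) (bigD1 x)//= lerDl sumr_ge0// => y _.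
exact: prob_ge0.
Qed.

(** The preimage of a Borel set under evaluation at [x] is a generator of [dist_measurable_sets]. *)
Lemma measurable_eval_dist (R : realType) (V : finType)
    (d : measure_display) (K : measurableType d) (f : K -> dist R V) (x : V) :
  measurable_dist_fun f -> measurable_fun setT (fun k => f k x).
Proof.
move=> mf _ B mB; rewrite setTI.
apply: (mf [set P : dist R V | B (P x)]).
by apply: sub_sigma_algebra; exists x, B.
Qed.

Theorem theorem4p1 (R : realType) (V : finType) (V_nonempty : (0 < #|V|)%N)
    (d : measure_display) (K : measurableType d) (PK : probability K R)
    (F : dist R V -> K -> dist R V)
    (F_measurable : forall P : dist R V, measurable_dist_fun (F P))
    (F_distortion_free : distortion_free PK F)
    (P : dist R V) :
  ('E_PK[fun k => entropy (F P k)] <= (entropy P)%:E)%E.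
Proof.
have mF x : measurable_fun setT (fun k => F P k x).
  exact: measurable_eval_dist.
have F01 x k : 0 <= F P k x <= 1 by rewrite prob_ge0 dist_le1.
rewrite unlock /entropy.
(* With the sign inside the sum every summand is nonnegative, which lets the integral pass through
   the sum. *)
under eq_integral do rewrite -sumrN -sumEFin.
rewrite ge0_integral_sum//; last 2 first.
- by move=> x; exact/measurable_EFinP/measurable_xlnx.
- by move=> x k _; rewrite lee_fin oppr_ge0 xlnx_le0.
rewrite -sumrN -sumEFin; apply: lee_sum => x _.
apply: integral_xlnx_le => //; first exact: prob_ge0.
by have := F_distortion_free P x; rewrite unlock.
Qed.
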